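(* Let $G$ be a finite simple undirected graph with maximum degree $\Delta$ and independence number $\alpha(G)$. If $I$ is a $1$-maximal independent set in $G$, then $$\alpha(G) \le \left(\frac{\Delta}{2} + 1\right)|I|.$$
   Context: Graphs are finite, simple, unweighted and undirected. An independent set is a set of pairwise non-adjacent vertices; it is maximal if no proper superset of it is independent. The independence number $\alpha(G)$ is the largest size of an independent set of $G$. Given an independent set $I$ in $G$, a $j$-swap consists of removing $j$ vertices from $I$ and inserting at least $j+1$ vertices into it so that the result is again an independent set. An independent set $I$ is $k$-maximal if it is a maximal independent set and no $j$-swap is available in $I$ for any $j \in \{1,\dots,k\}$. *)

(* Defs.v *)
From mathcomp Require Import all_boot.

Set Implicit Arguments.
Unset Strict Implicit.
Unset Printing Implicit Defensive.

Record sgraph (V : finType) := SGraph {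
  adj :> rel V;
  adj_sym : symmetric adj;
  adj_irrefl : irreflexive adj
}.

Section Graph.
Variables (V : finType) (G : sgraph V).
Implicit Types (I S A B : {set V}) (j k : nat).

Definition degree (v : V) : nat := #|[set w | G v w]|.

(* Equal to 0 for the graph without vertices. *)
Definition max_degree : nat := \max_(v : V) degree v.

Definition independent S : bool :=
  [forall u in S, forall v in S, ~~ G u v].

Definition independence_number : nat :=
  \max_(S : {set V} | independent S) #|S|.

(* A is the set of removed vertices and B the set of inserted ones; the
   inserted vertices are new, i.e. outside I. *)
Definition is_swap I j A B : bool :=
  [&& A \subset I, #|A| == j, [disjoint B & I], j.+1 <= #|B|
    & independent ((I :\: A) :|: B)].

Definition has_swap I j : Prop := exists A B, is_swap I j A B.

Definition k_maximal k I : Prop :=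
  maxset independent I /\ (forall j, 1 <= j <= k -> ~ has_swap I j).

End Graph.

(* Main.v *)
(** Let [S] be a maximum independent set.  Each vertex of [S \ I] has a
    neighbour in [I] by maximality; call it private to [u] when [u] is its only
    neighbour in [I].  Two vertices of [S \ I] private to the same [u] would give
    a 1-swap, so each [u] has at most one.  Counting the edges between [S \ I]
    and [I \ S], with the edge to a private vertex counted twice, thus gives
    [2 |S \ I| <= (Delta + 1) |I \ S|]. *)
Require Import Defs.
From mathcomp Require Import all_boot all_order all_algebra.
From mathcomp Require Import zify.
Import Order.TTheory GRing.Theory Num.Theory.
Local Open Scope ring_scope.

Section OneMaximal.
Set Implicit Arguments.
Unset Strict Implicit.
Local Open Scope nat_scope.
Variables (V : finType) (G : sgraph V).
Implicit Types (I S : {set V}) (u v w : V).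

(** Being boolean, it is summed below as a 0/1 weight alongside [G u v]. *)
Definition private I u v : bool := [set w in I | G w v] == [set u].

Lemma independentP S :
  reflect {in S &, forall u v, ~~ G u v} (independent G S).
Proof.
apply: (iffP forall_inP) => [H u v uS vS | H u uS].
  exact: (forall_inP (H u uS)).
by apply/forall_inP => v vS; apply: H.
Qed.

Lemma privateP I u v :
  private I u v -> [/\ u \in I, G u v & {in I, forall w, G w v -> w = u}].
Proof.
move=> /eqP uv; have Nv := fun w => congr1 (fun A : {set V} => w \in A) uv.
have := Nv u; rewrite !inE eqxx => /andP[uI Guv]; split => // w wI Gwv.
by have := Nv w; rewrite !inE wI Gwv => /esym/eqP.
Qed.

(** Otherwise [v |: I] would be a larger independent set. *)
Lemma maximal_independent_neighbour I v :
  maxset (independent G) I -> v \notin I -> exists2 u, u \in I & G u v.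
Proof.
move=> /maxsetP[indI maxI] vI; apply/exists_inP; apply: contraNT vI.
rewrite negb_exists_in => /forall_inP vN.
have -> : I = v |: I; last exact: setU11.
apply/esym/maxI; last exact: subsetU1.
apply/independentP => x y; rewrite !inE.
move=> /predU1P[->|xI] /predU1P[->|yI]; first by rewrite adj_irrefl.
- by rewrite adj_sym vN.
- exact: vN.
- exact: (independentP _ indI).
Qed.

Lemma private_uniq I S u v w :
  k_maximal G 1 I -> independent G S -> v \in S :\: I -> w \in S :\: I ->
  private I u v -> private I u w -> v = w.
Proof.
move=> [/maxsetP[/independentP indI _] noswap] /independentP indS.
move=> /setDP[vS vI] /setDP[wS wI] /privateP[uI Guv Nv] /privateP[_ Guw Nw].
apply/eqP/idPn => vw; apply: (noswap 1) => //.
(* Trading [u] for [v] and [w] is a 1-swap: [u] was their only neighbour in [I], and they are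
   non-adjacent, both lying in [S]. *)
exists [set u], [set v; w]; apply/and5P; split.
- by rewrite sub1set.
- by rewrite cards1.
- by rewrite disjoint_subset; apply/subsetP => x; rewrite !inE => /orP[] /eqP->.
- by rewrite cards2 vw.
have cross x y : x \in I :\ u -> y \in [set v; w] -> ~~ G x y.
  move=> /setD1P[xu xI] /set2P[]->; apply: contraNN xu => Gxy; apply/eqP.
    exact: Nv.
  exact: Nw.
have subS x : x \in [set v; w] -> x \in S by move=> /set2P[]->.
apply/independentP => x y /setUP[xA|xB] /setUP[yA|yB].
- by move: xA yA => /setDP[xI _] /setDP[yI _]; apply: indI.
- exact: cross.
- by rewrite adj_sym cross.
- by apply: indS; apply: subS.
Qed.

Lemma sum_adj_le (J : {set V}) u : \sum_(v in J) G u v <= max_degree G.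
Proof.
apply: leq_trans (leq_bigmax u); rewrite /degree -sum1dep_card.
rewrite [leqRHS]big_mkcond [leqLHS]big_mkcond /=; apply: leq_sum => v _.
by case: (v \in J); case: (G u v).
Qed.

Lemma sum_private_le I S u :
  k_maximal G 1 I -> independent G S -> \sum_(v in S :\: I) private I u v <= 1.
Proof.
move=> maxI indS; rewrite -big_mkcondr sum1dep_card.
apply/card_le1_eqP => v w; rewrite !inE => /andP[vS pv] /andP[wS pw].
by apply: (private_uniq (u := u) maxI indS) => //; rewrite inE.
Qed.

(** Neighbours of [v] in [I] lie outside [S], as [S] is independent. Either [v] has a single one,
    which counts twice because [v] is private to it, or it has two that count once each. *)
Lemma two_le_adj_private I S v :
  k_maximal G 1 I -> independent G S -> v \in S :\: I ->
  2 <= \sum_(u in I :\: S) (G u v + private I u v).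
Proof.
move=> [maxI _] /independentP indS /setDP[vS vI].
have inJ w : w \in I -> G w v -> w \in I :\: S.
  by move=> wI Gwv; rewrite inE wI andbT; apply: contraTN Gwv => wS; apply: indS.
have [u uI Guv] := maximal_independent_neighbour maxI vI.
rewrite (bigD1 u) ?inJ //= Guv.
have [|Np] := boolP (private I u v); first by rewrite leq_addr.
(* Without a second neighbour in [I], [v] would be private to [u], against [Np]. *)
have [w /and3P[wI Gwv wu]] : exists w, [&& w \in I, G w v & w != u].
  apply/existsP; apply: contraNT Np; rewrite negb_exists => /forallP Nw.
  apply/eqP/setP => w; rewrite !inE; apply/idP/eqP => [/andP[wI Gwv]|->].
    by have := Nw w; rewrite wI Gwv negbK => /eqP.
  by rewrite uI.
by rewrite (bigD1 w) /= ?inJ // Gwv.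
Qed.

Lemma card_setD_one_maximal I S :
  k_maximal G 1 I -> independent G S ->
  2 * #|S :\: I| <= (max_degree G + 1) * #|I :\: S|.
Proof.
move=> maxI indS; rewrite mulnC -sum_nat_const mulnC -sum_nat_const.
apply: (@leq_trans
  (\sum_(v in S :\: I) \sum_(u in I :\: S) (G u v + private I u v))).
  by apply: leq_sum => v; apply: two_le_adj_private.
(* Seen from [u], the edges contribute at most [max_degree G] and the private vertex at most 1. *)
rewrite exchange_big /=; apply: leq_sum => u _; rewrite big_split /=.
by rewrite leq_add ?sum_adj_le ?sum_private_le.
Qed.

Lemma independence_number_one_maximal I :
  k_maximal G 1 I ->
  2 * independence_number G <= (max_degree G + 2) * #|I|.
Proof.
(* Moving the factor 2 to the right isolates the maximum, so that each independent [S] can be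
   bounded separately. *)
move=> maxI; rewrite mulnC -leq_divRL //; apply/bigmax_leqP => S indS.
rewrite leq_divRL //; have := card_setD_one_maximal maxI indS.
(* The common part [I :&: S] is counted with factor 2 on the left and [max_degree G + 2] on the
   right. *)
by rewrite -(cardsID I S) -(cardsID S I) setIC; nia.
Qed.

End OneMaximal.

Theorem theorem2 (V : finType) (G : sgraph V) (I : {set V})
    (hI : k_maximal G 1 I) :
  (independence_number G)%:R <= ((max_degree G)%:R / 2 + 1) * #|I|%:R :> rat.
Proof.
have := independence_number_one_maximal hI.
rewrite -(ler_nat rat) !natrM natrD => le2.
rewrite -(ler_pM2l (x := 2)) // mulrA mulrDr mulr1 mulrCA divff // mulr1.
exact: le2.
Qed.
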